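(* Let $(p^i_n)_{n\ge1}$, $i=1,\dots,m$, be always valid p-value processes for the hypotheses $H_0^i:\theta^i=\theta^i_0$ (with arbitrary dependence across $i$), let $\alpha\in(0,1)$, and let $T$ be an arbitrary stopping time. Then the set of decisions obtained by applying the Bonferroni procedure at level $\alpha$ to $\mathbf p_T=(p^1_T,\dots,p^m_T)$ controls the family-wise error rate at level $\alpha$: for every $\boldsymbol\theta=(\theta^1,\dots,\theta^m)$, $$\mathbb P_{\boldsymbol\theta}\big(\text{some } i \text{ with } \theta^i=\theta_0^i \text{ is rejected}\big)\le\alpha.$$
   Context: $m$ experiments are run simultaneously; at each step one observation is made on every experiment. Stopping times are with respect to the filtration generated by all the data and may be infinite. $(p^i_n)_n$ is an always valid p-value process for $H^i_0$ if it is $[0,1]$-valued, adapted and, whenever $\theta^i=\theta^i_0$, $\mathbb P_{\boldsymbol\theta}(T<\infty,\ p^i_T\le s)\le s$ for every stopping time $T$ and $s\in[0,1]$. The Bonferroni procedure at level $\alpha$ rejects exactly the hypotheses $i$ with $p^i_T\le\alpha/m$; nothing is rejected if $T=\infty$. *)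

(* Defs.v *)
From HB Require Import structures.
From mathcomp Require Import all_boot all_order all_algebra.
From mathcomp Require Import all_classical all_reals all_analysis.
Set Implicit Arguments.
Unset Strict Implicit.
Unset Printing Implicit Defensive.
Import Order.TTheory GRing.Theory Num.Theory.
Local Open Scope classical_set_scope.
Local Open Scope ring_scope.

(* Time runs over n >= 1: a process is a function of n : nat whose value at
   n = 0 is irrelevant, and no definition below depends on it. *)

Section Sequential.
Context {d : measure_display} {Omega : measurableType d}.

(* Generated by the first n observations of all m experiments jointly. *)
Definition data_filtration (m : nat) (dE : 'I_m -> measure_display)
    (E : forall i, measurableType (dE i))
    (X : forall i, nat -> {mfun Omega >-> E i}) (n : nat) : set (set Omega) :=
  <<s \bigcup_(k in [set k | (1 <= k <= n)%N])
        \bigcup_(i in [set: 'I_m])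
          preimage_set_system setT (X i k) measurable >>.

(* [None] is the value +oo. *)
Definition stopping_time (F : nat -> set (set Omega))
    (T : Omega -> option nat) : Prop :=
  (forall w, T w <> Some 0%N) /\
  (forall n, F n [set w | exists2 k, (k <= n)%N & T w = Some k]).

Definition adapted {R : realType} (F : nat -> set (set Omega))
    (p : nat -> Omega -> R) : Prop :=
  forall n, (1 <= n)%N ->
  forall B : set R, measurable B -> F n (p n @^-1` B).

Context {R : realType} {m : nat} {Theta : 'I_m -> Type}.
Variables (P : (forall i, Theta i) -> probability Omega R)
          (theta0 : forall i, Theta i).

(* [p] is an always valid p-value process for the hypothesis
   theta i = theta0 i; the other coordinates of theta are unrestricted. *)
Definition always_valid (F : nat -> set (set Omega)) (i : 'I_m)
    (p : nat -> Omega -> R) : Prop :=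
  [/\ forall n, (1 <= n)%N -> forall w, 0 <= p n w <= 1,
      adapted F p
    & forall theta, theta i = theta0 i ->
      forall T, stopping_time F T ->
      forall s : R, 0 <= s <= 1 ->
      (P theta [set w | exists2 n, T w = Some n & (p n w <= s)%R] <= s%:E)%E].

Definition bonferroni (alpha : R) (q : 'I_m -> R) : {set 'I_m} :=
  [set i | q i <= alpha / m%:R]%SET.

Definition decisions_at (proc : ('I_m -> R) -> {set 'I_m})
    (p : 'I_m -> nat -> Omega -> R) (T : Omega -> option nat)
    (w : Omega) : {set 'I_m} :=
  if T w is Some n then proc (fun i => p i n w) else finset.set0.

Definition FWER (rejected : Omega -> {set 'I_m}) (theta : forall i, Theta i) :
    \bar R :=
  P theta [set w | exists2 i, theta i = theta0 i & i \in rejected w].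

End Sequential.

(* Main.v *)
Require Import Defs.
From HB Require Import structures.
From mathcomp Require Import all_boot all_order all_algebra.
From mathcomp Require Import all_classical all_reals all_analysis.
Import Order.TTheory GRing.Theory Num.Theory.
Local Open Scope classical_set_scope.
Local Open Scope ring_scope.

(** The proof is a union bound. A true null [i] is rejected exactly when [T] is finite and [p i] at
    time [T] is at most [alpha / m]. Always-validity, applied to this very [T], bounds that event by
    [alpha / m], and there are at most [m] true nulls. Subadditivity is blind to the dependence
    between experiments. It does require measurable events, which [stopped_le_measurable]
    supplies. *)

Lemma measure_bigsetU_le (R : realType) (d : measure_display)
    (T : measurableType d) (mu : {measure set T -> \bar R}) (I : Type)
    (s : seq I) (Q : pred I) (A : I -> set T) :
  (forall i, measurable (A i)) ->
  (mu (\big[setU/set0]_(i <- s | Q i) A i) <= \sum_(i <- s | Q i) mu (A i))%E.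
Proof.
move=> mA; elim: s => [|i s IHs]; first by rewrite !big_nil measure0.
rewrite !big_cons; case: ifP => // _.
apply: (le_trans (measureU2 _ (mA i) _)); first exact: bigsetU_measurable.
exact: leeD.
Qed.

Lemma data_filtration_measurable (d : measure_display)
    (Omega : measurableType d) (m : nat)
    (dE : 'I_m -> measure_display) (E : forall i : 'I_m, measurableType (dE i))
    (X : forall i : 'I_m, nat -> {mfun Omega >-> E i}) (n : nat) :
  data_filtration X n `<=` measurable.
Proof.
apply: smallest_sub; first exact: sigma_algebra_measurable.
move=> A [k _] [i _] [B mB <-].
by rewrite setTI; exact: measurable_funPTI.
Qed.

(** For positive times the event is the difference of two consecutive events of the form [T <= n];
    at time 0 it is empty, since [T] never takes that value. *)
Lemma stopping_time_eq_measurable (d : measure_display)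
    (Omega : measurableType d) (F : nat -> set (set Omega))
    (T : Omega -> option nat) (n : nat) :
  (forall k, F k `<=` measurable) -> stopping_time F T ->
  measurable [set w | T w = Some n].
Proof.
move=> mF [T_neq0 FT]; case: n => [|n].
  rewrite (_ : [set _ | _] = set0); first exact: measurable0.
  by apply/seteqP; split=> w // /T_neq0.
rewrite (_ : [set _ | _] =
    [set w | exists2 k, (k <= n.+1)%N & T w = Some k] `\`
    [set w | exists2 k, (k <= n)%N & T w = Some k]).
  by apply: measurableD; apply: mF; apply: FT.
apply/seteqP; split=> w /= => [Tw|[[k]]].
  split; first by exists n.+1.
  by rewrite Tw => -[k kn [nk]]; rewrite -nk ltnn in kn.
rewrite leq_eqVlt => /orP[/eqP-> //|kn Tw] [].
by exists k.
Qed.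

(** Splitting by the value of [T] gives a countable union in which [q] is frozen at a fixed time.
    The union starts at 1 because adaptedness says nothing about time 0. *)
Lemma stopped_le_measurable (R : realType) (d : measure_display)
    (Omega : measurableType d) (F : nat -> set (set Omega))
    (T : Omega -> option nat) (q : nat -> Omega -> R) (s : R) :
  (forall k, F k `<=` measurable) -> stopping_time F T -> adapted F q ->
  measurable [set w | exists2 n, T w = Some n & q n w <= s].
Proof.
move=> mF hT hq.
rewrite (_ : [set _ | _] = \bigcup_(n in [set n | (1 <= n)%N])
    ([set w | T w = Some n] `&` q n @^-1` `]-oo, s])).
  apply: bigcup_measurable => n n1.
  apply: measurableI; first exact: stopping_time_eq_measurable hT.
  by apply: (mF n); apply: hq => //; exact: measurable_itv.
apply/seteqP; split=> w /=.
  move=> [[|n] Tw qs]; first by case: hT => /(_ w).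
  by exists n.+1 => //; split=> //=; rewrite in_itv.
by move=> [n _ [Tw /=]]; rewrite in_itv /= => qs; exists n.
Qed.

Theorem proposition7 (R : realType) (d : measure_display)
    (Omega : measurableType d) (m : nat)
    (dE : 'I_m -> measure_display) (E : forall i : 'I_m, measurableType (dE i))
    (X : forall i : 'I_m, nat -> {mfun Omega >-> E i})
    (Theta : 'I_m -> Type) (theta0 : forall i : 'I_m, Theta i)
    (P : (forall i : 'I_m, Theta i) -> probability Omega R)
    (p : 'I_m -> nat -> Omega -> R)
    (hp : forall i : 'I_m, always_valid P theta0 (data_filtration X) i (p i))
    (alpha : R) (halpha : 0 < alpha < 1)
    (T : Omega -> option nat) (hT : stopping_time (data_filtration X) T)
    (theta : forall i : 'I_m, Theta i) :
  (FWER P theta0 (decisions_at (bonferroni alpha) p T) theta <= alpha%:E)%E.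
Proof.
have /andP[alpha0 alpha1] := halpha.
pose A i := [set w | exists2 n, T w = Some n & p i n w <= alpha / m%:R].
have mA i : measurable (A i).
  have [_ hpi _] := hp i.
  exact: stopped_le_measurable (@data_filtration_measurable _ _ _ _ _ X) hT hpi.
(* The error event is the union of the [A i] over true nulls; outcomes with [T w = None] reject
   nothing. The index condition goes through [asbool] because [Theta i] is an arbitrary type. *)
rewrite /FWER (_ : [set _ | _] =
    \big[setU/set0]_(i | `[< theta i = theta0 i >]) A i); last first.
  rewrite -bigcup_seq_cond; apply/seteqP; split=> w /=.
    move=> [i theta_i]; rewrite /decisions_at; case Tw: (T w) => [n|].
      rewrite inE => pi; exists i; last by exists n.
      by rewrite /= mem_index_enum; apply/asboolP.
    by rewrite inE.
  move=> [i /= /andP[_ /asboolP theta_i] [n Tw pi]]; exists i => //.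
  by rewrite /decisions_at Tw inE.
apply: (le_trans (measure_bigsetU_le _ _ _ _ _ _ _ _ mA)).
apply: (@le_trans _ _ (\sum_(i < m) (alpha / m%:R)%:E)%E).
  (* Extend the sum to all [m] indices: a false null contributes 0, which is at most [alpha / m]. *)
  rewrite [leLHS]big_mkcond; apply: lee_sum => i _.
  have m0 : (0 < m)%N by apply: leq_ltn_trans (ltn_ord i).
  have s0 : 0 <= alpha / m%:R by rewrite divr_ge0 // ltW.
  case: ifPn => [/asboolP theta_i|_]; last by rewrite lee_fin.
  have [_ _ valid] := hp i.
  (* The level [alpha / m] is admissible in [valid], since [alpha < 1 <= m]. *)
  apply: valid => //; rewrite s0 ler_pdivrMr ?ltr0n// mul1r.
  by rewrite (le_trans (ltW alpha1))// ler1n.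
rewrite sumEFin lee_fin sumr_const card_ord -[leLHS]mulr_natr.
(* With no experiments, [m] cannot be cancelled, but the total is then 0. *)
have [->|m0] := eqVneq m 0%N; first by rewrite mulr0 ltW.
by rewrite divfK // pnatr_eq0.
Qed.
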